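(* Let $R$ be a divisibly closed supertropical domain, and let $f\in R\lfloor\lambda_1,\dots,\lambda_n\rfloor$ be a polynomial. Then $f$ is weakly $(\nu,e)$-equivalent to the polynomial corresponding to its essential polyhedron $\bar C_f$, and $\bar C_{f^{\mathrm{es}}}=\bar C_f$.
   Context: All semirings are commutative (in both operations), with zero $0_R$ and unit $1_R$. A supertropical semiring is a triple $(R,\mathcal G_0,\nu)$ where $R$ is a semiring, $\mathcal G_0=\mathcal G\cup\{0_R\}$ is a semiring ideal of $R$ (the ghost ideal), and $\nu:R\to\mathcal G_0$ (written $a^\nu=\nu(a)$) is a semiring homomorphism with $\nu^2=\nu$ (where $\mathcal G_0$ is a semiring with unit $\nu(1_R)$), such that: $a+a=a^\nu$ for all $a$; $a+b\in\{a,b\}$ whenever $a^\nu\ne b^\nu$; and $a+b=a^\nu$ whenever $a^\nu=b^\nu$. $\mathcal G_0$ is totally ordered by $g\ge h\iff g+h=g$; write $a>_\nu b$ for $a^\nu>b^\nu$. It is a supertropical domain if the set $\mathcal T=R\setminus\mathcal G_0$ of tangible elements is a multiplicative monoid and $\nu|_{\mathcal T}:\mathcal T\to\mathcal G$ is onto. The divisible closure $\bar R$ of a supertropical domain $R$ consists of formal roots $\sqrt[m]{a}$ ($a\in R$, $m\ge1$), with $\sqrt[m]{a}=\sqrt[m']{b}$ when $a^{m'n}=b^{mn}$ for some $n\ge 1$, product $\sqrt[m]{a}\sqrt[m']{b}=\sqrt[mm']{a^{m'}b^m}$, sum $\sqrt[m]{a}+\sqrt[m']{b}=\sqrt[mm']{a^{m'}+b^m}$,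 and $\nu(\sqrt[m]{a})=\sqrt[m]{a^\nu}$. $R$ is divisibly closed if $\bar R=R$ (identifying $a$ with $\sqrt[1]{a}$). $R\lfloor\lambda_1,\dots,\lambda_n\rfloor$ is the semiring of formal polynomials $f=\sum_{\mathbf i}\alpha_{\mathbf i}\Lambda^{\mathbf i}$. Writing the (divisible) monoid $\mathcal G$ additively, $C_f$ is the convex hull (with rational weights) of the points $(\mathbf i,\alpha_{\mathbf i}^\nu)$, $\alpha_{\mathbf i}\ne0_R$; its upper part $\bar C_f$ (the points whose last coordinate is maximal for given first $n$ coordinates) is the essential polyhedron of $f$. The polynomial corresponding to $\bar C_f$ is the sum of those monomials $\alpha_{\mathbf i}\Lambda^{\mathbf i}$ of $f$ for which $(\mathbf i,\alpha_{\mathbf i}^\nu)$ is a vertex of $\bar C_f$. A monomial $h$ of $f$ is essential if $h(\mathbf a)>_\nu f_h(\mathbf a)$ for some $\mathbf a\in R^{(n)}$, where $f_h$ is the sum of the other monomials; $f^{\mathrm{es}}$ is the sum of the essential monomials of $f$. Polynomials $f,g$ are weakly $(\nu,e)$-equivalent if $f(\mathbf a)^\nu=g(\mathbf a)^\nu$ for all $\mathbf a\in R^{(n)}$.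
   Formalization: The second claim, that f^es and f have the same essential polyhedron, is proved only when the ghost monoid G is a group with more than one element; without this it fails, e.g. for R={0,1,1^ν} and f=1+λ, where f^es=1. *)

(* Defs.v *)
From HB Require Import structures.
From mathcomp Require Import all_boot all_order all_algebra.
From mathcomp Require Import finmap.
From mathcomp Require Import boolp classical_sets.

Set Implicit Arguments.
Unset Strict Implicit.
Unset Printing Implicit Defensive.

Import Order.TTheory GRing.Theory Num.Theory.

Local Open Scope classical_set_scope.
Local Open Scope ring_scope.

(* [ghost0] is the ghost ideal G_0 = G \cup {0}.  [ghost0_mul1] says that       *)
(* [nu 1] is the unit of the semiring G_0.                                      *)
HB.mixin Record isSupertropical R of GRing.ComPzSemiRing R := {
  ghost0 : {pred R};
  nu : R -> R;
  ghost0_0 : 0 \in ghost0;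
  ghost0_D : forall a b, a \in ghost0 -> b \in ghost0 -> a + b \in ghost0;
  ghost0_M : forall a b, b \in ghost0 -> a * b \in ghost0;
  ghost0_mul1 : forall a, a \in ghost0 -> nu 1 * a = a;
  nu_ghost0 : forall a, nu a \in ghost0;
  nu_0 : nu 0 = 0;
  nu_D : forall a b, nu (a + b) = nu a + nu b;
  nu_M : forall a b, nu (a * b) = nu a * nu b;
  nu_idem : forall a, nu (nu a) = nu a;
  nu_double : forall a, a + a = nu a;
  nu_bipotent : forall a b, nu a <> nu b -> a + b = a \/ a + b = b;
  nu_supertrop : forall a b, nu a = nu b -> a + b = nu a
}.

#[short(type="supertropicalType")]
HB.structure Definition Supertropical :=
  { R of GRing.ComPzSemiRing R & isSupertropical R }.

HB.mixin Record isSupertropicalDomain R of Supertropical R := {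
  tangible_1 : (1 : R) \notin ghost0;
  tangible_M : forall a b : R,
    a \notin ghost0 -> b \notin ghost0 -> a * b \notin ghost0;
  nu_onto : forall g : R, g \in ghost0 -> g <> 0 ->
    exists2 t : R, t \notin ghost0 & nu t = g
}.

#[short(type="supertropicalDomainType")]
HB.structure Definition SupertropicalDomain :=
  { R of Supertropical R & isSupertropicalDomain R }.

(* The set G of nonzero ghosts; it is a monoid with unit [nu 1].                *)
Definition ghost {R : supertropicalType} (g : R) : Prop :=
  g \in ghost0 /\ g <> 0.

Definition ghost_le {R : supertropicalType} (h g : R) : Prop := g + h = g.

Definition nu_gt {R : supertropicalType} (a b : R) : Prop :=
  ghost_le (nu b) (nu a) /\ nu a <> nu b.

(* Elements of the divisible closure are formal roots modulo [root_eq].         *)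
Record formal_root (R : supertropicalType) := FormalRoot {
  radicand : R;
  root_index : nat;
  root_index_gt0 : (0 < root_index)%N
}.

Definition root_eq {R : supertropicalType} (x y : formal_root R) : Prop :=
  exists2 k : nat, (0 < k)%N &
    radicand x ^+ (root_index y * k) = radicand y ^+ (root_index x * k).

Definition root1 {R : supertropicalType} (a : R) : formal_root R :=
  FormalRoot a (ltn0Sn 0).

(* The canonical map from R to its divisible closure is bijective.              *)
Definition divisibly_closed (R : supertropicalType) : Prop :=
  (forall a b : R, root_eq (root1 a) (root1 b) -> a = b) /\
  (forall x : formal_root R, exists a : R, root_eq (root1 a) x).

(* Formal polynomials: finitely supported families of coefficients indexed by   *)
(* exponents.  ({mpoly R[n]} is not available, as it needs a ring R.)           *)
Definition exponent (n : nat) := {ffun 'I_n -> nat}.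

Definition formal_poly (R : supertropicalType) (n : nat) :=
  {fsfun exponent n -> R for fun=> 0}.

Section Polynomials.
Context {R : supertropicalType} {n : nat}.
Implicit Types (f g : formal_poly R n) (i : exponent n) (a : 'I_n -> R).

Definition eval_monomial f i a : R := f i * \prod_(k < n) a k ^+ i k.

Definition eval_formal_poly f a : R := \sum_(i <- finsupp f) eval_monomial f i a.

(* The sum of the monomials of f whose exponent satisfies P.                    *)
Definition subpoly (P : exponent n -> Prop) f : formal_poly R n :=
  [fsfun i in finsupp f => if `[< P i >] then f i else 0].

Definition weakly_equivalent f g : Prop :=
  forall a, nu (eval_formal_poly f a) = nu (eval_formal_poly g a).

Definition essential f i : Prop :=
  f i <> 0 /\ exists a : 'I_n -> R,
    nu_gt (eval_monomial f i a) (eval_formal_poly (subpoly (fun j => j <> i) f) a).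

Definition essential_part f : formal_poly R n := subpoly (essential f) f.

(* Points of Q^n x G; the second component is only ever taken in G.             *)
Definition point := ('rV[rat]_n * R)%type.

(* For q >= 0: h is the multiple q g of g in the additively written monoid G,   *)
(* i.e. the rational power g^q.  The [nu] matters only for q = 0, where g ^+ 0  *)
(* is 1 in R but must be read as the unit [nu 1] of G.                          *)
Definition ghost_rat_power (g : R) (q : rat) (h : R) : Prop :=
  ghost h /\ h ^+ `|denq q|%N = nu (g ^+ `|numq q|%N).

Definition convex_combination (m : nat) (w : 'I_m -> rat) (p : 'I_m -> point)
    (q : point) : Prop :=
  [/\ forall j, 0 <= w j,
      \sum_(j < m) w j = 1,
      q.1 = \sum_(j < m) w j *: (p j).1
    & exists2 h : 'I_m -> R,
        forall j, ghost_rat_power (p j).2 (w j) (h j)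
      & q.2 = \prod_(j < m) h j].

Definition convex_hull (S : set point) : set point :=
  [set q | exists m (w : 'I_m -> rat) (p : 'I_m -> point),
     (forall j, S (p j)) /\ convex_combination w p q].

Definition poly_point f i : point := (\row_k (i k)%:R, nu (f i)).

Definition poly_hull f : set point :=
  convex_hull [set poly_point f i | i in [set i | f i <> 0]].

Definition essential_polyhedron f : set point :=
  [set p | poly_hull f p /\
     forall b : R, poly_hull f (p.1, b) -> ghost_le b p.2].

Definition vertex (S : set point) : set point :=
  [set p | S p /\ ~ convex_hull (S `\ p) p].

Definition polyhedron_poly f : formal_poly R n :=
  subpoly (fun i => vertex (essential_polyhedron f) (poly_point f i)) f.

End Polynomials.

Arguments point : clear implicits.

(* The monoid G is a group with more than one element.  Together with the       *)
(* divisibility of G this makes (G, written additively) a nonzero ordered       *)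
(* Q-vector space.  Without it a vertex of the essential polyhedron need not    *)
(* come from an essential monomial: if G = {1}, or if G is the additive monoid  *)
(* of nonnegative rationals, then the monomial X of X^2 + X is never strictly   *)
(* dominant, although both monomials give vertices.                             *)
Definition ghost_nontrivial_group (R : supertropicalType) : Prop :=
  (forall g : R, ghost g -> exists2 h : R, ghost h & g * h = nu 1) /\
  (exists2 g : R, ghost g & g <> nu 1).

(* Main.v *)
From HB Require Import structures.
From mathcomp Require Import all_boot all_order all_algebra.
From mathcomp Require Import finmap.
From mathcomp Require Import boolp classical_sets.
Require Import Defs.

(** The ghosts form a totally ordered monoid [G] with unique roots.  It is also
    cancellative: if [a < b] in the order of [nu], and [b] and [c] are tangible, then
    [c * b + c * a = c * b] is tangible, which excludes [nu (c * a) = nu (c * b)]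
    ([nult_mul2l]).  So [G], written additively, embeds in an ordered
    rational vector space, and the theorem is linear programming over it.

    After clearing denominators, a convex combination with rational weights is
    the average of a nonempty list of points, repetitions being allowed.  A point
    [p] lies on or below a point of the hull of [S] exactly when it is dominated
    by the average of such a list; in multiplicative notation, [p.2 ^+ N] is at
    most the product of the heights of the [N] points of the list.  In this form
    no division is needed.  Domination is transitive, and if a list that
    dominates [p] contains [p], then the copies of [p] can be cancelled.

    Among the points of [f], choose a set [s] that dominates all the points and
    is irredundant: no point of [s] is dominated by the other ones
    ([exists_irredundant]).  The key fact ([irredundant_extreme]) is that if
    points dominated by [s] have an average on or above some [p] in [s], then
    they lie over the same exponent as [p], and not above it.

    - Hence the points of [s] are vertices of the essential polyhedron.  The value
      of a dominated monomial at any argument is at most the largest value of the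
      monomials that dominate it, so the vertices have the same values as [f].

    - Hence, also, no point of [s] is dominated by the other points of [f].  When
      [G] is a nontrivial group, a theorem of the alternative over the ordered
      group [G] ([transposition], proved by Fourier-Motzkin elimination) turns
      this into an argument at which the corresponding monomial is strictly larger
      than all the others, so that it is essential.  The essential monomials
      therefore dominate all the points of [f], and the two hulls have the same
      upper part ([dominated_polyhedron]). *)

Set Implicit Arguments.
Unset Strict Implicit.
Unset Printing Implicit Defensive.

Import Order.TTheory GRing.Theory Num.Theory.

Local Open Scope ring_scope.

(** * The order of ghost values *)

Section GhostOrder.
Context {R : supertropicalType}.
Implicit Types a b c d : R.

(** A total preorder on the whole of [R], so that coefficients, tangible or ghost,
    can be compared without first replacing them by their ghosts. *)
Definition nule a b : bool := nu b + nu a == nu b.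

Lemma nu_ghostE a : a \in ghost0 -> nu a = a.
Proof. by move=> aG; rewrite -[RHS]ghost0_mul1 // -!nu_double mulrDl mul1r. Qed.

(** Adding [0] to [a] does not change it, but gives [nu a] if [nu a = nu 0]. *)
Lemma nu_eq0 a : nu a = 0 -> a = 0.
Proof. by move=> a0; have := @nu_supertrop R a 0; rewrite nu_0 addr0 a0; apply. Qed.

Lemma nu_exp a m : nu (a ^+ m.+1) = nu a ^+ m.+1.
Proof. by elim: m => [|m IH]; rewrite ?expr1 // exprS nu_M IH -exprS. Qed.

Lemma nule_ghostP a b : reflect (ghost_le (nu a) (nu b)) (nule a b).
Proof. exact: eqP. Qed.

Lemma nule_refl a : nule a a.
Proof. by rewrite /nule nu_double nu_idem. Qed.

Lemma nule_total a b : nule a b || nule b a.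
Proof.
rewrite /nule [X in _ || (X == _)]addrC.
have [e|/eqP ne] := eqVneq (nu a) (nu b); first by rewrite e nu_double nu_idem eqxx.
have [|->|->] := @nu_bipotent R (nu b) (nu a).
- by rewrite !nu_idem => e; case: ne.
- by rewrite eqxx.
- by rewrite eqxx orbT.
Qed.

Lemma nuleNge a b : ~~ nule a b -> nule b a.
Proof. by have := nule_total a b; case: nule. Qed.

Lemma nule_trans b a c : nule a b -> nule b c -> nule a c.
Proof. by move=> /eqP ab /eqP bc; rewrite /nule -{1}bc -addrA ab bc. Qed.

Lemma nule_anti a b : nule a b -> nule b a -> nu a = nu b.
Proof. by move=> /eqP ab /eqP <-; rewrite addrC ab. Qed.

Lemma eq_nule a b : nu a = nu b -> nule a b.
Proof. by move=> e; rewrite /nule e nu_double nu_idem. Qed.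

Lemma nule0 a : nule 0 a.
Proof. by rewrite /nule nu_0 addr0. Qed.

Lemma nule_eq0 a : nule a 0 = (nu a == 0).
Proof. by rewrite /nule nu_0 add0r. Qed.

Lemma nule_mul a b c d : nule a b -> nule c d -> nule (a * c) (b * d).
Proof.
move=> ab cd; apply: (@nule_trans (b * c)).
  by rewrite /nule !nu_M -mulrDl (eqP ab).
by rewrite /nule !nu_M -mulrDr (eqP cd).
Qed.

Lemma nule_exp m a b : nule a b -> nule (a ^+ m) (b ^+ m).
Proof.
move=> ab; elim: m => [|m IH]; first exact: nule_refl.
by rewrite !exprS nule_mul.
Qed.

Lemma nule_prod (I : eqType) (s : seq I) (F H : I -> R) :
  (forall i, i \in s -> nule (F i) (H i)) ->
  nule (\prod_(i <- s) F i) (\prod_(i <- s) H i).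
Proof.
elim: s => [|i s IH] le; rewrite ?big_nil ?nule_refl // !big_cons.
apply: nule_mul; first by apply: le; rewrite mem_head.
by apply: IH => j js; apply: le; rewrite inE js orbT.
Qed.

Lemma nule_sum (I : eqType) (s : seq I) (F : I -> R) b :
  (forall i, i \in s -> nule (F i) b) -> nule (\sum_(i <- s) F i) b.
Proof.
elim: s => [|i s IH] le; rewrite ?big_nil ?nule0 // big_cons.
rewrite /nule nu_D addrA (eqP (le i (mem_head _ _))).
by apply: IH => j js; apply: le; rewrite inE js orbT.
Qed.

Lemma nule_sum_mem (I : eqType) (s : seq I) (F : I -> R) i :
  i \in s -> nule (F i) (\sum_(j <- s) F j).
Proof.
move=> si; rewrite (perm_big _ (perm_to_rem si)) big_cons.
by rewrite /nule nu_D addrAC nu_double nu_idem.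
Qed.

Lemma nult_sum (I : eqType) (s : seq I) (F : I -> R) b : nu b != 0 ->
  (forall i, i \in s -> ~~ nule b (F i)) -> ~~ nule b (\sum_(i <- s) F i).
Proof.
move=> b0; elim: s => [|i s IH] lt; rewrite ?big_nil ?nule_eq0 // big_cons.
have ltS : ~~ nule b (\sum_(j <- s) F j).
  by apply: IH => j js; apply: lt; rewrite inE js orbT.
have [le|/nuleNge le] := boolP (nule (F i) (\sum_(j <- s) F j)).
  apply: contra ltS => h; apply: (nule_trans h).
  by rewrite /nule nu_D addrCA nu_double nu_idem addrC; rewrite /nule in le.
apply: contra (lt i (mem_head _ _)) => h; apply: (nule_trans h).
by rewrite /nule nu_D addrA nu_double nu_idem.
Qed.

End GhostOrder.

Section Cancellation.
Context {R : supertropicalDomainType}.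
Implicit Types a b c : R.

(** This is where closure of the tangible elements under products is used: for
    tangible lifts [t] of [c] and [u] of [b] one has [u + nu a = u], hence
    [t * u + t * nu a = t * u]; if the two terms had the same ghost, their sum
    [t * u] would be a ghost. *)
Lemma nult_mul2l c a b : nu c != 0 -> ~~ nule b a -> ~~ nule (c * b) (c * a).
Proof.
move=> c0 ltab; have b0 : nu b != 0.
  by apply: contraNneq ltab => b0; apply: (@nule_trans _ 0); rewrite ?nule0 ?nule_eq0 ?b0.
have [t tT tc] := nu_onto _ (nu_ghost0 c) (elimN eqP c0).
have [u uT ub] := nu_onto _ (nu_ghost0 b) (elimN eqP b0).
have ne : nu u <> nu (nu a).
  by rewrite nu_idem ub => /eq_nule h; rewrite h in ltab.
have absorb : u + nu a = u.
  have [//|e] := nu_bipotent _ _ ne; case/negP: ltab.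
  by rewrite /nule -ub addrC -{2}(nu_idem a) -{2}e nu_D nu_idem.
apply/negP => le.
have : nu (t * u) = nu (t * nu a).
  rewrite !nu_M nu_idem ub tc -!nu_M; apply: nule_anti => //.
  by apply: nule_mul (nule_refl _) (nuleNge ltab).
move/nu_supertrop; rewrite -mulrDr absorb => tu.
by have := tangible_M _ _ tT uT; rewrite tu nu_ghost0.
Qed.

Lemma nule_mul2l c a b : nu c != 0 -> nule (c * a) (c * b) -> nule a b.
Proof. by move=> c0; apply: contraLR; apply: nult_mul2l. Qed.

Lemma nu_mul_neq0 a b : nu a != 0 -> nu b != 0 -> nu (a * b) != 0.
Proof.
by move=> a0 b0; rewrite -nule_eq0 -(mulr0 a) nult_mul2l // nule_eq0.
Qed.

Lemma nu1_neq0 : nu (1 : R) != 0.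
Proof. by apply/eqP => /nu_eq0 e; have := @tangible_1 R; rewrite e ghost0_0. Qed.

Lemma nu_prod_neq0 (I : eqType) (s : seq I) (F : I -> R) :
  (forall i, i \in s -> nu (F i) != 0) -> nu (\prod_(i <- s) F i) != 0.
Proof.
elim: s => [|i s IH] h; rewrite ?big_nil ?nu1_neq0 // big_cons.
rewrite nu_mul_neq0 ?h ?mem_head // IH // => j js.
by rewrite h // inE js orbT.
Qed.

Lemma nu_exp_neq0 a m : nu a != 0 -> nu (a ^+ m) != 0.
Proof.
by move=> a0; elim: m => [|m IH]; rewrite ?nu1_neq0 // exprS nu_mul_neq0.
Qed.

(** By cancellation, taking powers preserves strict inequalities; so roots are
    unique up to [nu]. *)
Lemma nule_exp_inv m a b : (0 < m)%N -> nule (a ^+ m) (b ^+ m) -> nule a b.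
Proof.
case: m => // m _; apply: contraLR => lt; have a0 : nu a != 0.
  by apply: contraNneq lt => /nu_eq0 ->; rewrite nule0.
elim: m => [|m IH]; rewrite ?expr1 // exprS [X in _ * X]exprS -exprS.
apply: contra (nult_mul2l a0 IH) => /nule_trans; apply.
by rewrite exprS nule_mul ?nule_refl // nuleNge.
Qed.

Lemma nu_exp_inj m a b : (0 < m)%N -> nu (a ^+ m) = nu (b ^+ m) -> nu a = nu b.
Proof.
move=> m0 e; apply: nule_anti; apply: (nule_exp_inv m0); apply: eq_nule; rewrite e //.
Qed.

Lemma ghostE (g : R) : ghost g <-> g \in ghost0 /\ nu g != 0.
Proof.
split=> -[gG g0]; split=> //; first by rewrite nu_ghostE //; apply/eqP.
by move=> e; rewrite e nu_0 eqxx in g0.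
Qed.

Lemma ghost_nu a : nu a != 0 -> ghost (nu a).
Proof. by move=> /eqP a0; split=> //; apply: nu_ghost0. Qed.

Lemma ghost_root (m : nat) (g : R) : divisibly_closed R -> (0 < m)%N -> ghost g ->
  exists2 h : R, ghost h & h ^+ m = g.
Proof.
move=> [_ roots] m0 /ghostE[gG g0].
have [a [k k0 /= e]] := roots (FormalRoot g m0).
rewrite mul1n in e; have e' : nu (a ^+ m) = nu g.
  by apply: (nu_exp_inj k0); rewrite -exprM e.
exists (nu a); last first.
  by case: m m0 e' {e} => // m _ e'; rewrite -nu_exp e' nu_ghostE.
apply: ghost_nu; apply: contra_neq g0 => /nu_eq0 a0.
by rewrite -e' a0 expr0n; case: m m0 {e e'} => // m _; rewrite nu_0.
Qed.

End Cancellation.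

(** * Domination by averages of points *)

Section Copies.
Context {I : eqType}.
Implicit Types s t : seq I.

(** Repeating a list multiplies all the integer weights that it encodes. *)
Definition copies m s : seq I := flatten (nseq m s).

Lemma size_copies m s : size (copies m s) = (m * size s)%N.
Proof. by rewrite size_flatten /shape map_nseq sumn_nseq mulnC. Qed.

Lemma mem_copies m s : copies m.+1 s =i s.
Proof.
elim: m => [|m IH] i; first by rewrite /copies /= cats0.
by rewrite /copies /= mem_cat -/(copies m.+1 s) IH orbb.
Qed.

Lemma sum_copies (W : nmodType) m s (F : I -> W) :
  \sum_(i <- copies m s) F i = (\sum_(i <- s) F i) *+ m.
Proof.
elim: m => [|m IH]; first by rewrite /copies big_nil.
by rewrite /copies /= big_cat /= -/(copies m s) IH mulrS.
Qed.

Lemma prod_copies (A : comPzSemiRingType) m s (F : I -> A) :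
  \prod_(i <- copies m s) F i = (\prod_(i <- s) F i) ^+ m.
Proof.
elim: m => [|m IH]; first by rewrite /copies big_nil.
by rewrite /copies /= big_cat /= -/(copies m s) IH exprS.
Qed.

End Copies.

Lemma all_eq_nseq (I : eqType) (t : seq I) (p : I) :
  (forall q, q \in t -> q = p) -> t = nseq (size t) p.
Proof. by move=> h; apply/all_pred1P/allP => q /h ->; apply/eqP. Qed.

Section Domination.
Context {R : supertropicalDomainType} {n : nat}.
Local Notation pt := (point R n).
Implicit Types (p q : pt) (t : seq pt) (S : set pt).

(** The list [t] encodes integer weights, the weight of a point being the number
    of its occurrences; both conditions are multiplied by the total weight. *)
Definition dominates t p : Prop :=
  [/\ (0 < size t)%N, p.1 *+ size t = \sum_(q <- t) q.1
    & nule (p.2 ^+ size t) (\prod_(q <- t) q.2)].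

Definition dominated S p : Prop := exists2 t, dominates t p & forall q, q \in t -> S q.

Lemma dominates1 p q : q.1 = p.1 -> nule p.2 q.2 -> dominates [:: q] p.
Proof. by move=> e le; split; rewrite ?big_seq1 ?mulr1n ?expr1. Qed.

Lemma dominated_self S p : S p -> dominated S p.
Proof.
move=> Sp; exists [:: p]; first by apply: dominates1; rewrite ?nule_refl.
by move=> q; rewrite inE => /eqP ->.
Qed.

Lemma dominated_sub S S' p : (forall q, S q -> S' q) -> dominated S p -> dominated S' p.
Proof. by move=> sub [t tp tS]; exists t => // q /tS/sub. Qed.

(** The lists [u q] may have different lengths.  They are concatenated after each
    of them has been repeated so that all lengths become equal to [L]. *)
Lemma dominates_flatten t (u : pt -> seq pt) :
    (forall q, q \in t -> dominates (u q) q) ->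
  exists L T, [/\ (0 < L)%N, size T = (L * size t)%N,
    T =i flatten (map u t), (\sum_(q <- t) q.1) *+ L = \sum_(q <- T) q.1
    & nule ((\prod_(q <- t) q.2) ^+ L) (\prod_(q <- T) q.2)].
Proof.
elim: t => [|p t IH] ut.
  exists 1%N, [::]; split; rewrite ?big_nil ?mul0rn ?expr1n ?nule_refl //.
have [|L [T [L0 sT mT eT lT]]] := IH.
  by move=> q qt; apply: ut; rewrite inE qt orbT.
have [s0 eu lu] := ut p (mem_head _ _).
exists (L * size (u p))%N, (copies L (u p) ++ copies (size (u p)) T); split.
- by rewrite muln_gt0 L0.
- by rewrite size_cat !size_copies sT mulnS mulnA [(_ * L)%N]mulnC.
- move=> q /=; rewrite !mem_cat; case: (L) L0 => // L' _.
  by case: (size _) s0 => // s' _; rewrite !mem_copies mT.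
- rewrite big_cons big_cat /= !sum_copies -eu -eT.
  by rewrite mulrnDl -!mulrnA [(L * _)%N]mulnC.
- rewrite big_cons big_cat /= !prod_copies exprMn; apply: nule_mul.
    by rewrite mulnC exprM nule_exp.
  by rewrite exprM nule_exp.
Qed.

(** Knowing which points occur in [T] is what allows one to decide whether copies
    of [p] can be cancelled. *)
Lemma dominates_trans t p (u : pt -> seq pt) :
  dominates t p -> (forall q, q \in t -> dominates (u q) q) ->
  exists2 T, dominates T p & T =i flatten (map u t).
Proof.
move=> [t0 et lt] /dominates_flatten[L [T [L0 sT mT eT lT]]]; exists T => //.
split; rewrite sT ?muln_gt0 ?L0 //.
  by rewrite mulnC mulrnA et eT.
by apply: nule_trans lT; rewrite mulnC exprM nule_exp.
Qed.

Lemma dominated_choice (S : set pt) t : (forall q, q \in t -> dominated S q) ->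
  exists u : pt -> seq pt,
    forall q, q \in t -> dominates (u q) q /\ forall r, r \in u q -> S r.
Proof.
move=> tS; pose P q u := q \in t -> dominates u q /\ forall r, r \in u -> S r.
suff /choice[u uP] : forall q, exists u, P q u by exists u.
move=> q; case: (boolP (q \in t)) => [/tS[u uq uS]|qt]; first by exists u.
by exists [::] => qt'; rewrite qt' in qt.
Qed.

Lemma dominated_trans S S' p :
  dominated S p -> (forall q, S q -> dominated S' q) -> dominated S' p.
Proof.
move=> [t tp tS] SS'; have [|u uP] := @dominated_choice S' t; first by move=> q /tS/SS'.
have [|T Tp TE] := @dominates_trans t p u tp; first by move=> q /uP[].
exists T => // r; rewrite TE => /flattenP[_ /mapP[q qt ->]].
by have [_ h] := uP q qt; apply: h.
Qed.

(** If [p] occurs [c] times in [t], then [c] copies of [p] can be cancelled from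
    the abscissas, and the factor [p.2 ^+ c] from the heights. *)
Lemma dominates_cancel t p : nu p.2 != 0 -> dominates t p ->
  has (predC1 p) t -> dominates [seq q <- t | q != p] p.
Proof.
move=> p0 [t0 et lt] tp; pose t' := [seq q <- t | q != p].
pose c := size [seq q <- t | q == p].
have tE : perm_eq t (nseq c p ++ t').
  have -> : nseq c p = [seq q <- t | q == p].
    by apply/esym/all_eq_nseq => q; rewrite mem_filter => /andP[/eqP].
  by rewrite perm_sym; apply/permPl/(perm_filterC (pred1 p)).
have st : size t = (c + size t')%N by rewrite (perm_size tE) size_cat size_nseq.
split; first by rewrite size_filter -has_count.
  move: et; rewrite st mulrnDr (perm_big _ tE) big_cat big_nseq /=.
  by rewrite iter_addr addr0 => /addrI.
apply: (@nule_mul2l _ (p.2 ^+ c)); first exact: nu_exp_neq0.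
move: lt; rewrite st exprD (perm_big _ tE) big_cat big_nseq /=.
by rewrite iter_mulr mulr1.
Qed.

Definition irredundant (s : seq pt) : Prop :=
  forall p, p \in s -> ~ dominated (fun q => q \in s /\ q <> p) p.

(** A point dominated by the other ones can be removed, by transitivity. *)
Lemma exists_irredundant (s : seq pt) : exists s' : seq pt,
  [/\ {subset s' <= s}, forall p, p \in s -> dominated (fun q => q \in s') p
    & irredundant s'].
Proof.
have [m] := ubnP (size s); elim: m s => // m IH s sm.
have [[p ps dp]|irr] :=
  pselect (exists2 p, p \in s & dominated (fun q => q \in s /\ q <> p) p); last first.
  exists s; split=> // [p ps|p ps dp]; first exact: dominated_self.
  by apply: irr; exists p.
have [|s' [s's ds' irr]] := IH [seq q <- s | q != p].
  rewrite -ltnS; apply: leq_trans sm; rewrite ltnS size_filter -(count_predC (predC1 p)) -addn1.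
  by rewrite leq_add2l -has_count; apply/hasP; exists p => //=; rewrite negbK.
exists s'; split=> // [q /s's|q qs]; first by rewrite mem_filter => /andP[].
have [->|qp] := eqVneq q p; last by apply: ds'; rewrite mem_filter qp.
apply: dominated_trans dp _ => r [rs /eqP rp].
by apply: ds'; rewrite mem_filter rp.
Qed.

Lemma mulrn_row_inj (v w : 'rV[rat]_n) m : (0 < m)%N -> v *+ m = w *+ m -> v = w.
Proof.
move=> m0; rewrite -!scaler_nat; apply: scalerI.
by rewrite pnatr_eq0 -lt0n.
Qed.

Lemma dominates_nseq m p q : dominates (nseq m p) q -> q.1 = p.1 /\ nule q.2 p.2.
Proof.
rewrite /dominates size_nseq !big_nseq iter_addr addr0 iter_mulr mulr1.
by move=> [m0 /(mulrn_row_inj m0) e /(nule_exp_inv m0)].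
Qed.

(** Replace each point of [t] by a list of points of [s] that dominates it.  The
    resulting list still dominates [p], so it consists of copies of [p] only:
    otherwise these could be cancelled, and [p] would be redundant.  Thus each
    point of [t] is itself dominated by copies of [p]. *)
Lemma irredundant_extreme (s : seq pt) t p :
    irredundant s -> p \in s -> nu p.2 != 0 -> dominates t p ->
    (forall q, q \in t -> dominated (fun r => r \in s) q) ->
  forall q, q \in t -> q.1 = p.1 /\ nule q.2 p.2.
Proof.
move=> irr ps p0 tp /dominated_choice[u uP].
have [|T Tp TE] := @dominates_trans t p u tp; first by move=> q /uP[].
have Tall : forall r, r \in T -> r = p.
  move=> r rT; apply: contrapT => /eqP rp; apply: (irr p ps).
  exists [seq q <- T | q != p].
    by apply: dominates_cancel => //; apply/hasP; exists r.
  move=> q; rewrite mem_filter TE => /andP[/eqP qp /flattenP[_ /mapP[q' q't ->]]].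
  by have [_ us] := uP q' q't => /us.
move=> q qt; have [uq us] := uP q qt.
have uE : u q = nseq (size (u q)) p.
  apply: all_eq_nseq => r ru; apply: Tall; rewrite TE.
  by apply/flattenP; exists (u q) => //; apply: map_f.
by rewrite uE in uq; apply: dominates_nseq uq.
Qed.

End Domination.

Section Hull.
Context {R : supertropicalDomainType} {n : nat}.
Local Notation pt := (point R n).
Implicit Types (p q : pt) (t : seq pt) (S : set pt).
Hypothesis hR : divisibly_closed R.

Lemma hull_sub S S' q : (forall p, S p -> S' p) -> convex_hull S q -> convex_hull S' q.
Proof. by move=> sub [m [w [p [pS wp]]]]; exists m, w, p; split=> // j; apply: sub. Qed.

(** Equal weights [1 / N] on the [N] entries realise the average.  Its height
    involves [N]-th roots of ghosts, which divisible closedness provides. *)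
Lemma hull_of_seq S t (x : 'rV[rat]_n) : (forall p, S p -> ghost p.2) ->
  (0 < size t)%N -> (forall q, q \in t -> S q) -> x *+ size t = \sum_(q <- t) q.1 ->
  exists2 b, convex_hull S (x, b) & b ^+ size t = \prod_(q <- t) q.2.
Proof.
move=> Sg t0 tS ex; pose N := size t.
have tN q : q \in t -> exists2 h, ghost h & h ^+ N = q.2.
  by move=> /tS/Sg; apply: ghost_root.
have /choice[h hP] :
    forall j : 'I_N, exists g, ghost g /\ g ^+ N = (tnth (in_tuple t) j).2.
  move=> j; have [|h hg hE] := tN (tnth (in_tuple t) j); last by exists h.
  exact: mem_tnth.
exists (\prod_(j < N) h j).
  exists N, (fun=> N%:R^-1), (tnth (in_tuple t)); split.
    by move=> j; apply: tS; exact: mem_tnth.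
  have N0 : N%:R != 0 :> rat by rewrite pnatr_eq0 -lt0n.
  split=> [j||/=|].
  - by rewrite invr_ge0 ler0n.
  - by rewrite sumr_const card_ord -[LHS]mulr_natr mulVf.
  - rewrite -scaler_sumr -(big_tnth _ _ t xpredT (fun q : pt => q.1)) -ex.
    by rewrite -scaler_nat scalerA mulVf // scale1r.
  - exists h => // j; have [hg hE] := hP j; split=> //.
    have -> : `|denq (N%:R^-1 : rat)|%N = N.
      by rewrite pmulrn denqVz //; apply: lt0n_neq0.
    have -> : `|numq (N%:R^-1 : rat)|%N = 1%N.
      rewrite pmulrn -[_^-1]mul1r -[1]/(1%:~R).
      by rewrite coprimeq_num ?coprime1n // gtr0_sg // ltz_nat.
    rewrite expr1 hE nu_ghostE //.
    by have [] := Sg _ (tS _ (mem_tnth j (in_tuple t))).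
rewrite -prodrXl (big_tnth _ _ t).
by apply: eq_bigr => j _; have [] := hP j.
Qed.

Lemma hull_self S p : (forall p, S p -> ghost p.2) -> S p -> convex_hull S p.
Proof.
move=> Sg Sp; have [||||b] := @hull_of_seq S [:: p] p.1 => //.
- by move=> q; rewrite inE => /eqP ->.
- by rewrite big_seq1.
by move=> hb; rewrite expr1 big_seq1 => bE; rewrite bE in hb; case: (p) hb.
Qed.

Lemma dominated_hull S p : (forall p, S p -> ghost p.2) -> dominated S p ->
  exists2 b, convex_hull S (p.1, b) & nule p.2 b.
Proof.
move=> Sg [t [t0 e le] tS].
have [b hb bE] := @hull_of_seq S t p.1 Sg t0 tS e.
by exists b => //; rewrite -bE in le; apply: nule_exp_inv le.
Qed.

(** The weights [w j] are brought to the common denominator [DD]; the list then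
    contains [p j] with multiplicity [w j * DD]. *)
Lemma hull_dominated S q : (forall p, S p -> ghost p.2) -> convex_hull S q ->
  ghost q.2 /\ dominated S q.
Proof.
move=> Sg [m [w [p [pS [w0 w1 q1 [h hP q2]]]]]].
have m0 : (0 < m)%N.
  case: m w p w1 {pS w0 q1 h hP q2} => // w p.
  by rewrite big_ord0 => /eqP; rewrite eq_sym oner_eq0.
have q2g : ghost q.2.
  rewrite q2; apply/ghostE; split; last first.
    by apply: nu_prod_neq0 => j _; have [/ghostE[]] := hP j.
  rewrite (bigD1 (Ordinal m0)) //= mulrC.
  by apply: ghost0_M; have [[]] := hP (Ordinal m0).
split=> //.
pose D j := `|denq (w j)|%N; pose N j := `|numq (w j)|%N.
(* [E j] is [DD] divided by [D j]. *)
pose E j := (\prod_(l < m | l != j) D l)%N.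
pose DD := (\prod_(l < m) D l)%N.
have D0 j : (0 < D j)%N by rewrite absz_gt0 denq_neq0.
have DE j : DD = (D j * E j)%N by rewrite /DD (bigD1 j).
have wD j : w j * DD%:R = (N j * E j)%:R.
  rewrite (DE j) natrM mulrA natrM; congr (_ * _).
  by rewrite /D /N !pmulrn gez0_abs ?denq_ge0 // gez0_abs ?numq_ge0 // numqE.
pose t := flatten [seq nseq (N j * E j) (p j) | j <- enum 'I_m].
have sum_t (W : nmodType) (F : pt -> W) : \sum_(q <- t) F q = \sum_j F (p j) *+ (N j * E j).
  rewrite big_flatten big_map big_enum /=; apply: eq_bigr => j _.
  by rewrite big_nseq iter_addr addr0.
have prod_t : \prod_(q <- t) q.2 = \prod_j (p j).2 ^+ (N j * E j).
  rewrite big_flatten big_map big_enum /=; apply: eq_bigr => j _.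
  by rewrite big_nseq iter_mulr mulr1.
have st : size t = DD.
  apply/eqP; rewrite -(eqr_nat rat) -sum1_size natr_sum sum_t.
  by under eq_bigr do [rewrite -wD]; rewrite -mulr_suml w1 mul1r.
have DD0 : (0 < DD)%N by rewrite prodn_gt0.
exists t; last first.
  by move=> r /flattenP[_ /mapP[j _ ->]] /nseqP[-> _].
split; rewrite st //.
  rewrite sum_t q1 -sumrMnl; apply: eq_bigr => j _.
  by rewrite -!scaler_nat scalerA mulrC wD.
rewrite prod_t q2 -prodrXl; apply: nule_prod => j _.
rewrite (DE j) !exprM nule_exp //; have [_ ->] := hP j.
by apply: eq_nule; rewrite nu_idem.
Qed.

End Hull.

(** * The points of a polynomial *)

Section Polynomials.
Context {R : supertropicalDomainType} {n : nat}.
Local Notation pt := (point R n).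
Hypothesis hR : divisibly_closed R.
Implicit Types (f g : formal_poly R n) (i j : exponent n) (a : 'I_n -> R).

Definition poly_points f : set pt := [set poly_point f i | i in [set i | f i <> 0]]%classic.

Lemma poly_points_ghost f p : poly_points f p -> ghost p.2.
Proof.
move=> [i fi <-]; apply: ghost_nu; apply/eqP => /nu_eq0; exact: fi.
Qed.

Lemma poly_point_nu_neq0 f p : poly_points f p -> nu p.2 != 0.
Proof. by move=> /poly_points_ghost/ghostE[]. Qed.

Lemma mem_poly_points f p :
  poly_points f p <-> p \in [seq poly_point f i | i <- finsupp f].
Proof.
split=> [[i fi <-]|/mapP[i fi ->]].
  by apply: map_f; rewrite mem_finsupp; apply/eqP.
by exists i => //; apply/eqP; rewrite -mem_finsupp.
Qed.

Lemma poly_point_inj f i j : (poly_point f i).1 = (poly_point f j).1 -> i = j.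
Proof.
move=> /rowP e; apply/ffunP => k; have := e k; rewrite !mxE => /eqP.
by rewrite eqr_nat => /eqP.
Qed.

Lemma subpolyE P f i : subpoly P f i = if `[< P i >] then f i else 0.
Proof.
rewrite fsfunE mem_finsupp; case: eqVneq => [->|//].
by rewrite if_same.
Qed.

Lemma subpoly_neq0 P f i : subpoly P f i <> 0 <-> P i /\ f i <> 0.
Proof. by rewrite subpolyE; case: asboolP => Pi; split=> // -[]. Qed.

Lemma poly_points_subpoly P f p : poly_points (subpoly P f) p <->
  exists2 i, P i /\ f i <> 0 & poly_point f i = p.
Proof.
split=> [[i /subpoly_neq0[Pi fi] <-]|[i [Pi fi] <-]]; exists i => //.
- by rewrite /poly_point subpolyE asboolT.
- exact/subpoly_neq0.
- by rewrite /poly_point subpolyE asboolT.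
Qed.

(** A higher point of the hull over the same abscissa would, as a one-element
    list, dominate [p]; this contradicts [irredundant_extreme]. *)
Lemma irredundant_upper f (s : seq pt) p :
    irredundant s -> (forall q, q \in s -> poly_points f q) ->
    (forall q, poly_points f q -> dominated (fun r => r \in s) q) ->
  p \in s -> essential_polyhedron f p.
Proof.
move=> irr sf fs ps; split=> [|b hb].
  by apply: hull_self (@poly_points_ghost f) _ => //; apply: sf.
apply: contrapT => lt.
have [bg db] := hull_dominated (@poly_points_ghost f) hb.
have := lt; have := nu_ghostE (proj1 bg).
have /nu_ghostE := proj1 (poly_points_ghost (sf p ps)).
move=> /= pE bE; rewrite -{1}pE -{1}bE => /nule_ghostP ltb.
have tp := @dominates1 _ _ p (p.1, b) erefl (nuleNge ltb).
have dt q : q \in [:: (p.1, b)] -> dominated (fun r => r \in s) q.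
  by rewrite inE => /eqP ->; apply: dominated_trans db fs.
have [_ /=] := irredundant_extreme irr ps (poly_point_nu_neq0 (sf p ps)) tp dt (mem_head _ _).
exact/negP.
Qed.

(** If other points of the upper hull had [p] in their hull, they would lie over
    the abscissa of [p], where there is only one upper point. *)
Lemma irredundant_vertex f (s : seq pt) p :
    irredundant s -> (forall q, q \in s -> poly_points f q) ->
    (forall q, poly_points f q -> dominated (fun r => r \in s) q) ->
  p \in s -> vertex (essential_polyhedron f) p.
Proof.
move=> irr sf fs ps; have [hp up] := irredundant_upper irr sf fs ps.
split=> // hull_p.
have dom q : poly_hull f q -> ghost q.2 /\ dominated (fun r => r \in s) q.
  move=> /(hull_dominated (@poly_points_ghost f))[qg dq]; split=> //.
  exact: dominated_trans dq fs.
have [|_ [t tp tS]] := hull_dominated _ hull_p; first by move=> q [[/dom[]]].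
have [t0 _ _] := tp; case: t t0 tp tS => // q t _ tp tS.
have [[hq uq] qp] := tS q (mem_head _ _).
have dt r : r \in q :: t -> dominated (fun r => r \in s) r by move=> /tS[[/dom[]]].
have [q1 lq] := irredundant_extreme irr ps (poly_point_nu_neq0 (sf p ps)) tp dt (mem_head _ _).
apply: qp; have [[qg _] _] := dom q hq; have [[pg _] _] := dom p hp.
have pq : nule p.2 q.2.
  apply/nule_ghostP; rewrite !nu_ghostE //; apply: uq.
  by rewrite q1; case: (p) hp.
have e2 := nule_anti lq pq; rewrite !nu_ghostE // in e2.
by case: (q) (p) q1 e2 => [x b] [y c] /= -> ->.
Qed.

(** Evaluation at [a] is a linear functional on the space of points.  Natural
    multiplicities make the argument valid also if some [a k] is [0]. *)
Lemma eval_dominates f i a (u : seq (exponent n)) :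
    dominates [seq poly_point f j | j <- u] (poly_point f i) ->
  nule (eval_monomial f i a ^+ size u) (\prod_(j <- u) eval_monomial f j a).
Proof.
move=> [_]; rewrite size_map !big_map /= => ex le.
rewrite exprMn big_split /=; apply: nule_mul.
  apply: (@nule_trans _ (nu (f i) ^+ size u)).
    by apply: nule_exp; apply: eq_nule; rewrite nu_idem.
  apply: nule_trans le _; apply: nule_prod => j _.
  by apply: eq_nule; rewrite nu_idem.
apply: eq_nule; congr nu; rewrite exchange_big /= -prodrXl.
apply: eq_bigr => k _; rewrite -exprM prodrXr; congr (_ ^+ _).
apply/eqP; rewrite -(eqr_nat rat) natr_sum natrM mulr_natr.
have /rowP/(_ k) := ex; rewrite summxE mulmxnE mxE => ->.
by apply/eqP/eq_bigr => j _; rewrite mxE.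
Qed.

(** A value is at most the maximum of the values whose weighted average bounds
    it, and a sum of values is their maximum. *)
Lemma eval_monomial_dominated f P i a :
    dominated (poly_points (subpoly P f)) (poly_point f i) ->
  nule (eval_monomial f i a) (eval_formal_poly (subpoly P f) a).
Proof.
move=> [t ti tP].
have [u tE uP] :
    exists2 u, t = [seq poly_point f j | j <- u] & forall j, j \in u -> P j /\ f j <> 0.
  elim: t tP {ti} => [|p t IH] tP; first by exists [::].
  have [|u -> uP] := IH; first by move=> q qt; apply: tP; rewrite inE qt orbT.
  have /poly_points_subpoly[j jP <-] := tP p (mem_head _ _).
  by exists (j :: u) => // j'; rewrite inE => /predU1P[->|/uP].
have u0 : (0 < size u)%N by have [] := ti; rewrite tE size_map.
rewrite tE in ti; apply: (nule_exp_inv u0).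
apply: nule_trans (eval_dominates a ti) _.
have -> (b : R) : b ^+ size u = \prod_(j <- u) b.
  by rewrite big_const_seq count_predT iter_mulr mulr1.
apply: nule_prod => j /uP[Pj fj].
have jS : j \in finsupp (subpoly P f) by rewrite mem_finsupp; apply/eqP/subpoly_neq0.
apply: nule_trans (nule_sum_mem _ jS); rewrite /eval_monomial subpolyE asboolT //.
exact: nule_refl.
Qed.

Lemma weakly_equivalent_subpoly f P :
    (forall p, poly_points f p ->
      dominated (poly_points (subpoly P f)) p) ->
  weakly_equivalent f (subpoly P f).
Proof.
move=> dom a; apply: nule_anti; apply: nule_sum => i.
  by rewrite mem_finsupp => /eqP fi; apply/eval_monomial_dominated/dom; exists i.
rewrite mem_finsupp => /eqP/subpoly_neq0[Pi /eqP fi].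
rewrite /eval_monomial subpolyE asboolT //; apply: nule_sum_mem.
by rewrite mem_finsupp.
Qed.

Lemma irredundant_support f : exists s : seq pt,
  [/\ irredundant s, forall p, p \in s -> poly_points f p &
      forall p, poly_points f p -> dominated (fun q => q \in s) p].
Proof.
have [s [sf fs irr]] := exists_irredundant [seq poly_point f i | i <- finsupp f].
exists s; split=> // p; first by move=> /sf/mem_poly_points.
by move=> /mem_poly_points/fs.
Qed.

Lemma polyhedron_poly_equivalent f : weakly_equivalent f (polyhedron_poly f).
Proof.
have [s [irr sf fs]] := irredundant_support f.
apply: weakly_equivalent_subpoly => p /fs; apply: dominated_sub => q qs.
have [i fi qi] := sf q qs; apply/poly_points_subpoly; exists i => //; split=> //.
by rewrite qi; apply: (irredundant_vertex irr sf fs).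
Qed.

(** The hull of the selected points lies inside the hull of all points, each point
    of which lies on or below a point of the smaller hull over the same abscissa;
    so both hulls have the same upper part. *)
Lemma dominated_polyhedron f P :
    (forall p, poly_points f p ->
      dominated (poly_points (subpoly P f)) p) ->
  essential_polyhedron (subpoly P f) = essential_polyhedron f.
Proof.
move=> dom.
have sub q : poly_hull (subpoly P f) q -> poly_hull f q.
  by apply: hull_sub => r /poly_points_subpoly[i [_ fi] <-]; exists i.
have above q : poly_hull f q -> exists2 b, poly_hull (subpoly P f) (q.1, b) & ghost_le q.2 b.
  move=> /(hull_dominated (@poly_points_ghost f))[[qg _] dq].
  have [||b hb le] := @dominated_hull _ _ hR (poly_points (subpoly P f)) q.
  - exact: poly_points_ghost.
  - exact: dominated_trans dq dom.
  exists b => //; move/nule_ghostP: le; rewrite !nu_ghostE //.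
  by have [[]] := hull_dominated (@poly_points_ghost (subpoly P f)) hb.
apply/seteqP; split=> q [hq uq]; split.
- exact: sub.
- move=> b /above[c /= /uq cq bc]; rewrite /ghost_le.
  by move: cq bc; rewrite /ghost_le => cq bc; rewrite -cq -addrA bc.
- have [c hc qc] := above q hq; have cq := uq _ (sub _ hc).
  suff -> : q = (q.1, c) by [].
  by rewrite [LHS]surjective_pairing; congr pair; rewrite -cq addrC qc.
- by move=> b /sub/uq.
Qed.

End Polynomials.

(** * A theorem of the alternative over ordered divisible groups *)

Section Transposition.
Context {V : zmodType} (pos : pred V).
Hypothesis pos0 : ~~ pos 0.
Hypothesis posD : forall x y, pos x -> pos y -> pos (x + y).
Hypothesis pos_total : forall x, ~~ pos x -> x = 0 \/ pos (- x).
Hypothesis divisible : forall m (x : V), exists y, y *+ m.+1 = x.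
Hypothesis nontrivial : exists x, pos x.
Implicit Types x y z : V.

Lemma pos_muln m x : (0 < m)%N -> pos (x *+ m) = pos x.
Proof.
case: m => // m _; have posM y : pos y -> pos (y *+ m.+1).
  by move=> py; elim: m => // m IH; rewrite mulrS posD.
apply/idP/idP => [|/posM//]; apply: contraTT => /pos_total[->|/posM].
  by rewrite mul0rn.
rewrite mulNrn => pN; apply: contra pos0 => p.
by rewrite -(addrN (x *+ m.+1)) posD.
Qed.

Lemma pos_le_trans x y z : pos (y - x) -> ~~ pos (y - z) -> pos (z - x).
Proof.
move=> pyx /pos_total[/subr0_eq <- //|]; rewrite opprB => pzy.
by rewrite -(subrKA y) posD.
Qed.

Lemma maximum (s : seq V) : s <> [::] ->
  exists2 m, m \in s & forall x, x \in s -> ~~ pos (x - m).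
Proof.
elim: s => // y [|z s] IH _.
  by exists y; rewrite ?mem_head // => x; rewrite inE => /eqP ->; rewrite subrr.
have [//|m ms mP] := IH; case: (boolP (pos (y - m))) => ym.
  exists y; first exact: mem_head.
  move=> x; rewrite inE => /predU1P[->|/mP xm]; first by rewrite subrr.
  apply: contra xm => xy; have := posD xy ym; by rewrite subrKA.
exists m => [|x]; first by rewrite inE ms orbT.
by rewrite inE => /predU1P[->//|/mP].
Qed.

(** With one of the lists empty, nontriviality gives a point beyond the extreme
    element of the other one; otherwise the midpoint of the largest lower bound
    and the smallest upper bound works. *)
Lemma between (ls us : seq V) : (forall l u, l \in ls -> u \in us -> pos (u - l)) ->
  exists x, (forall l, l \in ls -> pos (x - l)) /\ (forall u, u \in us -> pos (u - x)).
Proof.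
move=> lu; have [e pe] := nontrivial.
have lowest : us <> [::] -> exists2 m, m \in us & forall u, u \in us -> ~~ pos (m - u).
  move=> us0; have [|m /mapP[u uus ->] mP] := @maximum [seq - u | u <- us].
    by case: us us0 {lu}.
  exists u => // v vus; have := mP _ (map_f _ vus).
  by rewrite opprK addrC.
have [ls0|/eqP/maximum[l lls lP]] := eqVneq ls [::];
  have [us0|/eqP/lowest[u uus uP]] := eqVneq us [::].
- by exists 0; rewrite ls0 us0.
- exists (u - e); rewrite ls0; split=> // v vus.
  by apply: pos_le_trans (uP v vus); rewrite opprB addrCA subrr addr0.
- exists (l + e); rewrite us0; split=> // v vls.
  have := lP v vls; have [//|] := boolP (pos (l + e - v)).
  move=> /pos_total[e0|]; last first.
    rewrite opprB => p1; have := posD p1 pe.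
    by rewrite opprD addrA subrK => ->.
  have -> : v = l + e by apply/esym/subr0_eq.
  by rewrite addrAC subrr add0r pe.
have [x xE] := divisible 1 (l + u); have pul := lu l u lls uus.
have p1 : pos (x - l).
  by rewrite -(@pos_muln 2) // mulrnBl xE mulr2n [l + u]addrC opprD addrA addrK.
have p2 : pos (u - x).
  by rewrite -(@pos_muln 2) // mulrnBl xE mulr2n opprD addrACA subrr addr0.
exists x; split=> v vs; last exact: pos_le_trans p2 (uP v vs).
have := lP v vs; have [//|] := boolP (pos (x - v)).
move=> /pos_total[/subr0_eq <-|]; first by rewrite p1.
by rewrite opprB => p3; have := posD p3 p1; rewrite subrKA => ->.
Qed.

Context {n : nat}.
Local Notation constraint := (V * 'rV[int]_n)%type.
Implicit Types (c : constraint) (s t : seq constraint) (ks : seq 'I_n).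

(** A constraint [(v, d)] stands for the strict inequality
    [v + \sum_k a k * d k > 0] in the unknowns [a]. *)
Definition slack ks (a : 'I_n -> V) c : V := c.1 + \sum_(k <- ks) a k *~ c.2 0 k.

Lemma slackD ks a c d : slack ks a (c + d) = slack ks a c + slack ks a d.
Proof.
rewrite /slack addrACA; congr (_ + _); rewrite -big_split /=.
by apply: eq_bigr => k _; rewrite mxE mulrzDr.
Qed.

Lemma slackMn ks a c m : slack ks a (c *+ m) = slack ks a c *+ m.
Proof.
elim: m => [|m IH]; last by rewrite !mulrS slackD IH.
by rewrite /slack big1 ?addr0 // => k _; rewrite mxE mulr0z.
Qed.

(** The consequences of the constraints that are obtained by adding them, with
    natural multiplicities that do not all vanish. *)
Definition in_cone s c : Prop :=
  exists t, [/\ t <> [::], {subset t <= s} & c = \sum_(d <- t) d].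

Lemma in_coneD s c d : in_cone s c -> in_cone s d -> in_cone s (c + d).
Proof.
move=> [t [t0 ts ->]] [u [u0 us ->]]; exists (t ++ u); rewrite big_cat; split=> //.
  by case: t t0 {ts}.
by move=> x; rewrite mem_cat => /orP[/ts|/us].
Qed.

Lemma in_cone_mem s c : c \in s -> in_cone s c.
Proof.
by move=> cs; exists [:: c]; rewrite big_seq1; split=> // x; rewrite inE => /eqP ->.
Qed.

Lemma in_cone_sum s t : t <> [::] -> (forall c, c \in t -> in_cone s c) ->
  in_cone s (\sum_(c <- t) c).
Proof.
elim: t => // c [|d t] IH _ ts; first by rewrite big_seq1; apply: ts; rewrite mem_head.
rewrite big_cons; apply: in_coneD; first by apply: ts; rewrite mem_head.
by apply: IH => // e et; apply: ts; rewrite inE et orbT.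
Qed.

Lemma in_coneMn s c m : (0 < m)%N -> in_cone s c -> in_cone s (c *+ m).
Proof.
case: m => // m _ sc; elim: m => // m IH.
by rewrite mulrS; apply: in_coneD.
Qed.

Lemma mulrz_abs (x : V) (z : int) : 0 <= z -> x *~ z = x *+ `|z|.
Proof. by case: z. Qed.

Lemma coordMn c m k : (c *+ m).2 0 k = c.2 0 k *+ m.
Proof.
elim: m => [|m IH]; first by rewrite !mulr0n mxE.
by rewrite !mulrS mxE IH.
Qed.

(** Either the strict inequalities in the unknowns [ks] have a common solution, or
    adding some of them gives [v > 0] for a [v] that is not positive.  The unknown
    [k] is eliminated as usual: constraints with coefficients of opposite signs
    are combined in all ways so that [k] cancels; a solution of the combined
    system makes all the lower bounds on [k] smaller than all the upper bounds. *)
Lemma transposition ks s : uniq ks ->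
  (exists a, forall c, c \in s -> pos (slack ks a c)) \/
  (exists c, [/\ in_cone s c, forall k, k \in ks -> c.2 0 k = 0 & ~~ pos c.1]).
Proof.
elim: ks s => [|k ks IH] s.
  move=> _; have [[c cs npc]|h] := pselect (exists2 c, c \in s & ~~ pos c.1).
    by right; exists c; split=> //; apply: in_cone_mem.
  left; exists (fun=> 0) => c cs; rewrite /slack big_nil addr0.
  by apply: contrapT => /negP npc; apply: h; exists c.
move=> /= /andP[kks uks].
pose coef c := absz (c.2 0 k).
(* These multiplicities make the coefficients of the unknown [k] cancel. *)
pose comb (p q : constraint) : constraint := p *+ coef q + q *+ coef p.
pose P := [seq c : constraint <- s | 0 < c.2 0 k].
pose N := [seq c : constraint <- s | c.2 0 k < 0].
pose s' := [seq c : constraint <- s | c.2 0 k == 0] ++ [seq comb p q | p <- P, q <- N].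
have coef0 c : c.2 0 k != 0 -> (0 < coef c)%N by rewrite absz_gt0.
have coefP c : c \in P -> (0 < coef c)%N /\ c.2 0 k = (coef c : int).
  rewrite mem_filter => /andP[c0 _]; split; first by rewrite coef0 ?gt_eqF.
  by rewrite /coef gez0_abs // ltW.
have coefN c : c \in N -> (0 < coef c)%N /\ c.2 0 k = - (coef c : int).
  rewrite mem_filter => /andP[c0 _]; split; first by rewrite coef0 ?lt_eqF.
  by rewrite /coef ltz0_abs // opprK.
have s'P c : c \in s' -> in_cone s c /\ c.2 0 k = 0.
  rewrite mem_cat => /orP[|/allpairsP[[p q] /= [pP qN ->]]].
    by rewrite mem_filter => /andP[/eqP c0 cs]; split=> //; apply: in_cone_mem.
  have [p0 pE] := coefP p pP; have [q0 qE] := coefN q qN; split.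
    move: pP qN; rewrite !mem_filter => /andP[_ ps] /andP[_ qs].
    by apply: in_coneD; apply: in_coneMn => //; apply: in_cone_mem.
  by rewrite mxE !coordMn pE qE mulNrn -!natz -!mulrnA mulnC subrr.
have [[a aP]|[c [[t [t0 ts' ->]] c0 pc]]] := IH s' uks; last first.
  right; exists (\sum_(d <- t) d); split=> //.
    by apply: in_cone_sum => // d /ts'/s'P[].
  move=> l; rewrite inE => /predU1P[->|/c0//].
  elim: t {t0 c0 pc} ts' => [|d t IHt] ts'; first by rewrite big_nil mxE.
  rewrite big_cons mxE (proj2 (s'P d (ts' d (mem_head _ _)))) add0r.
  by apply: IHt => e et; apply: ts'; rewrite inE et orbT.
left.
(* [div x m] is used for [m] positive only; division is available by [m.+1]. *)
have /choice[dv dvP] : forall mx : nat * V, exists y, y *+ mx.1.+1 = mx.2.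
  by move=> [m x]; apply: divisible.
pose div x m := dv (m.-1, x).
have divK x m : (0 < m)%N -> div x m *+ m = x by case: m => // m _; apply: (dvP (m, x)).
pose e := slack ks a.
have [|x [xl xu]] := @between
    [seq div (- e p) (coef p) | p <- P] [seq div (e q) (coef q) | q <- N].
  move=> _ _ /mapP[p pP ->] /mapP[q qN ->].
  have [p0 _] := coefP p pP; have [q0 _] := coefN q qN.
  rewrite -(@pos_muln (coef p * coef q)) ?muln_gt0 ?p0 // mulrnBl.
  rewrite {1}mulnC !mulrnA divK // divK // mulNrn opprK.
  rewrite addrC -!slackMn -slackD; apply: aP; rewrite mem_cat; apply/orP; right.
  by apply/allpairsP; exists (p, q).
exists (fun l => if l == k then x else a l) => c cs.
have -> : slack (k :: ks) (fun l => if l == k then x else a l) c = e c + x *~ c.2 0 k.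
  rewrite /slack big_cons eqxx addrCA addrC; congr (_ + _ + _).
  by apply: eq_big_seq => l lks; case: eqVneq => // lk; rewrite -lk lks in kks.
have [c0|c0|c0] := ltrgt0P (c.2 0 k).
- have cP : c \in P by rewrite mem_filter c0.
  have [p0 cE] := coefP c cP; have := xl _ (map_f _ cP).
  rewrite -(pos_muln _ p0) mulrnBl divK // opprK addrC.
  by rewrite mulrz_abs // ltW.
- have cN : c \in N by rewrite mem_filter c0.
  have [p0 cE] := coefN c cN; have := xu _ (map_f _ cN).
  by rewrite -(pos_muln _ p0) mulrnBl divK // cE mulrNz.
- rewrite c0 mulr0z addr0; apply: aP.
  by rewrite mem_cat mem_filter c0 eqxx cs.
Qed.

End Transposition.

(** * Essential monomials *)

Definition ghost_inverses (R : supertropicalType) : Prop :=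
  forall g : R, ghost g -> exists2 h : R, ghost h & g * h = nu 1.

Definition nonzero_ghost {R : supertropicalType} : pred R :=
  fun g => (g \in ghost0) && (nu g != 0).

(** The nonzero ghosts, to be written additively; the existence of inverses is a
    parameter of the type so that the group structure can be attached to it. *)
Definition ghost_group (R : supertropicalDomainType) (_ : ghost_inverses R) : Type :=
  {g : R | nonzero_ghost g}.

Section GhostGroup.
Context {R : supertropicalDomainType} (inv : ghost_inverses R).
Local Notation V := (ghost_group inv).

HB.instance Definition _ := Choice.on V.
HB.instance Definition _ := SubType.on V.

Implicit Types x y : V.

Lemma val_ghost x : val x \in ghost0.
Proof. by have /andP[] := valP x. Qed.

Lemma nu_val_neq0 x : nu (val x) != 0.
Proof. by have /andP[] := valP x. Qed.

Lemma nonzero_ghostM x y : nonzero_ghost (val x * val y).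
Proof. by rewrite /nonzero_ghost ghost0_M ?val_ghost // nu_mul_neq0 // nu_val_neq0. Qed.

Lemma nonzero_ghost1 : nonzero_ghost (nu 1 : R).
Proof. by rewrite /nonzero_ghost nu_ghost0 nu_idem nu1_neq0. Qed.

Definition ghost_add x y : V := Sub (val x * val y) (nonzero_ghostM x y).
Definition ghost_zero : V := Sub (nu 1) nonzero_ghost1.

Lemma ghost_inverse x : exists y : V, ghost_add y x = ghost_zero.
Proof.
have [|h /ghostE/andP hg hE] := inv (g := val x).
  by apply/ghostE; split; rewrite ?val_ghost ?nu_val_neq0.
by exists (Sub h hg); apply: val_inj; rewrite /= mulrC.
Qed.

Definition ghost_opp x : V := projT1 (cid (ghost_inverse x)).

Lemma ghost_addA : associative ghost_add.
Proof. by move=> x y z; apply: val_inj; rewrite /= mulrA. Qed.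

Lemma ghost_addC : commutative ghost_add.
Proof. by move=> x y; apply: val_inj; rewrite /= mulrC. Qed.

Lemma ghost_add0 : left_id ghost_zero ghost_add.
Proof. by move=> x; apply: val_inj; rewrite /= ghost0_mul1 ?val_ghost. Qed.

Lemma ghost_addN : left_inverse ghost_zero ghost_opp ghost_add.
Proof. by move=> x; rewrite /ghost_opp; case: cid. Qed.

HB.instance Definition _ :=
  GRing.isZmodule.Build V ghost_addA ghost_addC ghost_add0 ghost_addN.

Lemma val_ghostD x y : val (x + y) = val x * val y. Proof. by []. Qed.

Lemma val_ghost0 : val (0 : V) = nu 1. Proof. by []. Qed.

Lemma val_ghostMn x m : val (x *+ m) = nu (val x ^+ m).
Proof.
elim: m => [|m IH]; first by rewrite mulr0n val_ghost0.
by rewrite mulrS val_ghostD IH exprS nu_M (nu_ghostE (val_ghost x)).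
Qed.

Lemma val_ghost_sum (I : Type) (s : seq I) (F : I -> V) :
  val (\sum_(i <- s) F i) = nu (\prod_(i <- s) val (F i)).
Proof.
elim: s => [|i s IH]; first by rewrite !big_nil val_ghost0.
by rewrite !big_cons val_ghostD IH nu_M (nu_ghostE (val_ghost (F i))).
Qed.

Definition ghost_pos : pred V := fun x => ~~ nule (val x) 1.

Lemma ghost_posB x y : ghost_pos (y - x) = ~~ nule (val y) (val x).
Proof.
congr (~~ _); have -> : val y = val x * val (y - x) by rewrite -val_ghostD addrC subrK.
rewrite -[X in _ = nule _ X]mulr1; apply/idP/idP => [|/nule_mul2l].
  exact: nule_mul (nule_refl _).
by apply; apply: nu_val_neq0.
Qed.

Lemma ghost_posE x : ghost_pos x = ~~ nule (val x) (val (0 : V)).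
Proof. by rewrite -ghost_posB subr0. Qed.

Lemma ghost_pos0 : ~~ ghost_pos 0.
Proof. by rewrite ghost_posE nule_refl. Qed.

Lemma ghost_posD x y : ghost_pos x -> ghost_pos y -> ghost_pos (x + y).
Proof.
rewrite -{2}(opprK x) addrC ghost_posB => x0; rewrite ghost_posE => y0.
apply: contra y0 => /nule_trans; apply; apply: nuleNge.
by rewrite -ghost_posB sub0r opprK.
Qed.

Lemma val_ghost_inj x y : nu (val x) = nu (val y) -> x = y.
Proof. by rewrite !nu_ghostE ?val_ghost // => /val_inj. Qed.

Lemma ghost_pos_total x : ~~ ghost_pos x -> x = 0 \/ ghost_pos (- x).
Proof.
rewrite -sub0r ghost_posB ghost_posE negbK => le.
have [ge|] := boolP (nule (val (0 : V)) (val x)); last by right.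
by left; apply: val_ghost_inj; apply: nule_anti.
Qed.

Lemma ghost_divisible : divisibly_closed R ->
  forall m x, exists y, y *+ m.+1 = x.
Proof.
move=> hR m x; have [||h /ghostE/andP hg hE] := @ghost_root R m.+1 (val x) hR => //.
  by apply/ghostE; split; rewrite ?val_ghost ?nu_val_neq0.
exists (Sub h hg : V); apply: val_inj.
by rewrite val_ghostMn SubK hE nu_ghostE ?val_ghost.
Qed.

Lemma ghost_nontrivial : (exists2 g : R, ghost g & g <> nu 1) -> exists x, ghost_pos x.
Proof.
move=> [g /ghostE/andP gg g1]; pose x : V := Sub g gg.
have [px|/ghost_pos_total[x0|]] := boolP (ghost_pos x); first by exists x.
  by case: g1; rewrite -val_ghost0 -x0 SubK.
by exists (- x).
Qed.

Definition to_ghost_group (b : R) : V := insubd (0 : V) (nu b).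

Lemma val_to_ghost_group b : nu b != 0 -> val (to_ghost_group b) = nu b.
Proof. by move=> b0; rewrite val_insubd /nonzero_ghost nu_ghost0 nu_idem b0. Qed.

End GhostGroup.

Section Essential.
Context {R : supertropicalDomainType} {n : nat}.
Hypothesis hR : divisibly_closed R.
Hypothesis hG : ghost_nontrivial_group R.
Implicit Types (f : formal_poly R n) (i j : exponent n).

Let inv : ghost_inverses R := proj1 hG.
Local Notation V := (ghost_group inv).

Definition log_coef f i : V := to_ghost_group inv (f i).

(** The strict inequality between the monomial [i] and the larger monomial [j], as
    a constraint on the logarithms of the arguments. *)
Definition gap f j i : V * 'rV[int]_n :=
  (log_coef f j - log_coef f i, \row_k ((j k)%:Z - (i k)%:Z)).

Lemma val_log_coef f i : f i <> 0 -> val (log_coef f i) = nu (f i).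
Proof. by move=> fi; apply: val_to_ghost_group; apply/eqP => /nu_eq0. Qed.

Definition log_monomial f (a : 'I_n -> V) i : V :=
  log_coef f i + \sum_(k <- enum 'I_n) a k *+ i k.

Lemma val_log_monomial f (a : 'I_n -> V) i : f i <> 0 ->
  val (log_monomial f a i) = nu (eval_monomial f i (fun k => val (a k))).
Proof.
move=> fi; rewrite /log_monomial val_ghostD val_ghost_sum val_log_coef // -nu_M.
rewrite !nu_M; congr (_ * _); rewrite big_enum /=.
apply: (big_ind2 (fun x y => nu x = nu y)) => // [x y z t|k _].
  by rewrite !nu_M => -> ->.
by rewrite val_ghostMn nu_idem.
Qed.

Lemma slack_gap f (a : 'I_n -> V) j i :
  slack (enum 'I_n) a (gap f j i) = log_monomial f a j - log_monomial f a i.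
Proof.
rewrite /slack /log_monomial opprD addrACA; congr (_ + _).
rewrite -sumrB; apply: eq_bigr => k _.
by rewrite mxE mulrzBr.
Qed.

Lemma essential_of_dominant f j (a : 'I_n -> R) : f j <> 0 ->
    nu (eval_monomial f j a) != 0 ->
    (forall i, f i <> 0 -> i <> j ->
      ~~ nule (eval_monomial f j a) (eval_monomial f i a)) ->
  essential f j.
Proof.
move=> fj nz gt; split=> //; exists a.
have lt : ~~ nule (eval_monomial f j a)
    (eval_formal_poly (subpoly (fun i => i <> j) f) a).
  apply: nult_sum => // i; rewrite mem_finsupp => /eqP/subpoly_neq0[ij fi].
  by have := gt i fi ij; rewrite /eval_monomial subpolyE asboolT.
split; first by apply/nule_ghostP/nuleNge.
by move=> /eq_nule e; rewrite e in lt.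
Qed.

(** An infeasibility certificate is a list of exponents other than [j] whose mean
    is [j] and whose coefficients have a mean that is at least that of [j]. *)
Lemma dominated_of_gap f j c : f j <> 0 ->
    in_cone [seq gap f j i | i <- finsupp f & i != j] c ->
    (forall k, k \in enum 'I_n -> c.2 0 k = 0) -> ~~ ghost_pos c.1 ->
  dominated (poly_points (subpoly (fun i => i <> j) f)) (poly_point f j).
Proof.
move=> fj [t [t0 ts ->]].
have [u tE uP] :
    exists2 u, t = [seq gap f j i | i <- u] & forall i, i \in u -> i <> j /\ f i <> 0.
  elim: t ts {t0} => [|d t IH] ts; first by exists [::].
  have [|u -> uP] := IH; first by move=> e et; apply: ts; rewrite inE et orbT.
  have /mapP[i iP ->] := ts d (mem_head _ _).
  exists (i :: u) => // i'; rewrite inE => /predU1P[->|/uP//].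
  by move: iP; rewrite mem_filter mem_finsupp => /andP[/eqP ? /eqP ?].
have u0 : (0 < size u)%N by case: (u) tE t0 => // ->.
rewrite {t t0 ts}tE big_map => c0.
rewrite (big_morph fst (fun x y => erefl) erefl) /= sumrB ghost_posB negbK => le.
exists [seq poly_point f i | i <- u]; last first.
  by move=> p /mapP[i /uP iP ->]; apply/poly_points_subpoly; exists i.
split; rewrite ?size_map ?big_map //=; last first.
  apply: nule_trans (nule_trans le _); apply: eq_nule.
    rewrite big_const_seq count_predT iter_addr addr0 val_ghostMn nu_idem.
    by rewrite val_log_coef.
  rewrite val_ghost_sum nu_idem; congr nu; apply: eq_big_seq => i iu.
  by rewrite val_log_coef //; have [] := uP i iu.
apply/rowP => k; rewrite mulmxnE summxE mxE.
have := c0 k; rewrite mem_enum => /(_ isT).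
rewrite (big_morph (fun c : V * 'rV[int]_n => c.2 0 k) (op1 := +%R) (id1 := 0)); last 2 first.
- by move=> x y; rewrite mxE.
- by rewrite mxE.
under eq_bigr do rewrite mxE; rewrite sumrB => /subr0_eq e.
under [RHS]eq_bigr do rewrite mxE.
move/(congr1 (fun z : int => z%:~R : rat)): e.
rewrite big_const_seq count_predT iter_addr addr0 rmorphMn rmorph_sum /=.
by rewrite -pmulrn => ->; apply: eq_bigr => i _; rewrite -pmulrn.
Qed.

Lemma essential_of_undominated f j : f j <> 0 ->
    ~ dominated (poly_points (subpoly (fun i => i <> j) f)) (poly_point f j) ->
  essential f j.
Proof.
move=> fj undom.
have [[a aP]|[c [cc c0 cp]]] := transposition (@ghost_pos0 R inv) (@ghost_posD R inv)
  (@ghost_pos_total R inv) (@ghost_divisible R inv hR) (@ghost_nontrivial R inv (proj2 hG))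
  [seq gap f j i | i <- finsupp f & i != j] (enum_uniq 'I_n); last first.
  by case: undom; apply: dominated_of_gap cc c0 cp.
apply: (@essential_of_dominant f j (fun k => val (a k))) => //.
  by rewrite -nu_idem -val_log_monomial // nu_val_neq0.
move=> i fi ij; have := aP (gap f j i); rewrite slack_gap ghost_posB.
rewrite !val_log_monomial // /nule !nu_idem; apply; apply: map_f.
by rewrite mem_filter mem_finsupp; apply/andP; split; apply/eqP.
Qed.

(** If the other points of [f] dominated [p], then by [irredundant_extreme] one of
    them would have the same exponent as [p]. *)
Lemma irredundant_essential f (s : seq (point R n)) p :
    irredundant s -> (forall q, q \in s -> poly_points f q) ->
    (forall q, poly_points f q -> dominated (fun r => r \in s) q) ->
  p \in s -> poly_points (essential_part f) p.
Proof.
move=> irr sf fs ps; have [j fj pE] := sf p ps.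
apply/poly_points_subpoly; exists j => //; split=> //.
apply: essential_of_undominated => // -[t tj tP].
have [t0 _ _] := tj; case: t t0 tj tP => // q t _ tj tP.
have dt r : r \in q :: t -> dominated (fun r => r \in s) r.
  by move=> /tP/poly_points_subpoly[i [_ fi] <-]; apply: fs; exists i.
rewrite pE in tj; have nz := poly_point_nu_neq0 (sf p ps).
have [e _] := irredundant_extreme irr ps nz tj dt (mem_head _ _).
have /poly_points_subpoly[i [ij _] iE] := tP q (mem_head _ _).
by apply: ij; apply: (@poly_point_inj _ _ f); rewrite iE pE.
Qed.

Lemma essential_part_polyhedron f :
  essential_polyhedron (essential_part f) = essential_polyhedron f.
Proof.
have [s [irr sf fs]] := irredundant_support f.
apply: (dominated_polyhedron hR) => p /fs; apply: dominated_sub => q.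
exact: irredundant_essential irr sf fs.
Qed.

End Essential.

Theorem proposition8p7 (R : supertropicalDomainType) (n : nat)
    (hR : divisibly_closed R) (f : formal_poly R n) :
  weakly_equivalent f (polyhedron_poly f) /\
  (ghost_nontrivial_group R ->
   essential_polyhedron (essential_part f) = essential_polyhedron f).
Proof.
split; first exact: polyhedron_poly_equivalent.
by move=> hG; apply: essential_part_polyhedron.
Qed.
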